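(* Let $A$ be an $\omega\times\omega$ monic segmented first entries matrix with entries from $\omega$. Let $r\in\mathbb N$ and let $\mathbb N=\bigcup_{i=1}^r E_i$ be an $r$-coloring of $\mathbb N$. Then there exist $i\in\{1,2,\dots,r\}$ and vectors $\vec x,\vec y\in\mathbb N^\omega$ such that all the entries of $A\vec x$ and all the entries of $\vec y^{A}$ are in $E_i$.
   Context: $\mathbb N=\{1,2,3,\dots\}$, $\omega=\{0,1,2,\dots\}$. First entries matrix: a finite matrix with rational entries is a first entries matrix if (1) no row is $\vec 0$; (2) the first nonzero entry of each row is positive; (3) the first nonzero entries of any two rows are equal if they occur in the same column. Monic segmented first entries matrix: an $\omega\times\omega$ matrix $A=(a_{ij})$ with rational entries such that (1) no row of $A$ is $\vec 0$; (2) for each $i\in\omega$, $\{j\in\omega: a_{ij}\ne 0\}$ is finite; (3) there is an increasing sequence $\{\alpha_n\}_{n=0}^\infty$ in $\omega$ with $\alpha_0=0$ such that for each $n\in\omega$ the set $\{(a_{i,\alpha_n},a_{i,\alpha_n+1},\dots,a_{i,\alpha_{n+1}-1}): i\in\omega\}\setminus\{\vec 0\}$ is empty or is the set of rows of a finite first entries matrix, and the first nonzero entry of each nonzero vector $(a_{i,\alpha_n},a_{i,\alpha_n+1},\dots,a_{i,\alpha_{n+1}-1})$ is $1$. For $\vec y=(y_j)_{j\in\omega}\in\mathbb N^\omega$, $\vec y^{A}$ is the vector whose $i$-th entry is $\prod_{j} y_j^{a_{ij}}$. *)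

(* Defs.v *)
From mathcomp Require Import all_boot all_order all_algebra.
From mathcomp Require Import mathcomp_extra boolp classical_sets functions.
From mathcomp Require Import cardinality fsbigop.

Set Implicit Arguments.
Unset Strict Implicit.
Unset Printing Implicit Defensive.

Import Order.TTheory GRing.Theory Num.Theory.

Local Open Scope classical_set_scope.
Local Open Scope ring_scope.

Definition first_nonzero_at (v : nat) (w : 'rV[rat]_v) (j : 'I_v) : Prop :=
  w 0 j != 0 /\ forall k : 'I_v, (k < j)%N -> w 0 k = 0.

Record first_entries_matrix (u v : nat) (M : 'M[rat]_(u, v)) : Prop := {
  fem_row_neq0 : forall i, row i M != 0;
  fem_first_gt0 : forall i j, first_nonzero_at (row i M) j -> 0 < M i j;
  fem_first_eq : forall i i' j,
    first_nonzero_at (row i M) j -> first_nonzero_at (row i' M) j ->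
    M i j = M i' j
}.

(* (a_{i,s}, a_{i,s+1}, ..., a_{i,t-1}) *)
Definition segment (A : nat -> nat -> rat) (s t i : nat) : 'rV[rat]_(t - s) :=
  \row_(j < t - s) A i (s + j)%N.

Definition nonzero_segments (A : nat -> nat -> rat) (s t : nat) :
    set 'rV[rat]_(t - s) :=
  range (segment A s t) `\` [set 0].

Record monic_segmented_first_entries (A : nat -> nat -> rat) : Prop := {
  msfe_row_neq0 : forall i, exists j, A i j != 0;
  msfe_row_finite : forall i, finite_set [set j | A i j != 0];
  msfe_segments : exists alpha : nat -> nat,
    [/\ {homo alpha : m n / (m < n)%N}, alpha 0%N = 0%N &
      forall n : nat,
        let S := @nonzero_segments A (alpha n) (alpha n.+1) in
        (S = set0 \/
         exists (u : nat) (M : 'M[rat]_(u, alpha n.+1 - alpha n)),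
           first_entries_matrix M /\ S = range (fun i => row i M)) /\
        (forall w j, S w -> first_nonzero_at w j -> w 0 j = 1)]
}.

(* Both operations below are finitely supported as soon as every row of A has
   finite support. *)
Definition omega_mulv (A : nat -> nat -> nat) (x : nat -> nat) : nat -> nat :=
  fun i => (\big[addn/0%N]_(j \in [set: nat]) (A i j * x j)%N).

Definition omega_expv (y : nat -> nat) (A : nat -> nat -> nat) : nat -> nat :=
  fun i => (\big[muln/1%N]_(j \in [set: nat]) (y j ^ A i j)%N).

(* N = {1, 2, 3, ...} *)
Definition posnats : set nat := [set n | (0 < n)%N].

(* Main.v *)
(* In a commutative semigroup, call a set a J-set if for any finitely many
   sequences f_i it contains all of a + sum_(t in H) f_i(t) for some a and some
   finite nonempty H independent of i. J-sets are partition regular by the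
   Hales-Jewett theorem, so the ultrafilters consisting of J-sets form a nonempty
   closed two-sided ideal. If p is an idempotent of this ideal, then every member
   of p contains an image of every finite monic first entries matrix (induction
   on the number of columns), hence also an image of A: choose the segments one
   after the other as in Galvin's proof of Hindman's theorem.

   Applied to addition, this shows that there are ultrafilters all of whose
   members contain some A x; they form a closed left ideal for multiplication,
   because A (n x) = n (A x). This left ideal meets the ideal of multiplicative
   J-sets, so by the Ellis-Numakura lemma the intersection contains a
   multiplicative idempotent p. Every member of p contains some A x and some y^A,
   and some colour class is a member of p. *)

Require Import Defs.
From mathcomp Require Import all_boot all_order all_algebra.
From mathcomp Require Import mathcomp_extra boolp classical_sets functions.
From mathcomp Require Import cardinality fsbigop filter.
From Stdlib Require List.

Set Implicit Arguments.
Unset Strict Implicit.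
Unset Printing Implicit Defensive.

Local Open Scope classical_set_scope.

(** * The Hales-Jewett theorem *)

(* A combinatorial line is a word over [option A] with at least one [None];
   the [None]s are the moving coordinates. *)
Definition line_at (I A : finType) (l : I -> option A) (x : A) :
  {ffun I -> A} := [ffun i => odflt x (l i)].

Definition hales_jewett (A : finType) : Prop :=
  forall K : finType, exists I : finType, forall C : {ffun I -> A} -> K,
    exists2 l : I -> option A, (exists i, l i = None) &
      forall x y, C (line_at l x) = C (line_at l y).

(** Words over [A] are coloured through [g]. The image under [g] of a line is again a line, and its
    point at [f z] becomes the point at [z]. This allows the alphabet to be replaced by a convenient
    type. *)
Lemma hales_jewett_retract (A B : finType) (f : B -> A) (g : A -> B) :
  cancel f g -> hales_jewett A -> hales_jewett B.
Proof.
move=> fK HA K; have [I HI] := HA K; exists I => C.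
have [l [i li] Cl] := HI (fun w => C [ffun i => g (w i)]).
exists (omap g \o l) => [|x y]; first by exists i; rewrite /= li.
have lineE z : line_at (omap g \o l) z = [ffun i => g (line_at l (f z) i)].
  by apply/ffunP => j; rewrite !ffunE /=; case: (l j) => //=; rewrite fK.
by rewrite !lineE.
Qed.

Definition join_words (I J A : finType) (v : {ffun I -> A})
    (w : {ffun J -> A}) : {ffun I + J -> A} :=
  [ffun s => match s with inl i => v i | inr j => w j end].

Section ColorFocusing.
Variables (A K : finType) (a0 : A).

Definition embed_word (J : finType) (w : {ffun J -> A}) :
  {ffun J -> option A} := [ffun j => Some (w j)].

Definition embed_line (J : finType) (l : J -> option A) :
  J -> option (option A) := omap Some \o l.

(* A pair of a line and a colour: without its last point, at the letter [None],
   the line has that colour, and its last point is the common focus [w]. *)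
Definition focused_line (I : finType) (C : {ffun I -> option A} -> K)
    (w : {ffun I -> option A}) (lc : (I -> option (option A)) * K) : Prop :=
  [/\ exists i, lc.1 i = None, line_at lc.1 None = w &
      forall x, C (line_at lc.1 (Some x)) = lc.2].

Definition focused_family (I : finType) (C : {ffun I -> option A} -> K)
    (w : {ffun I -> option A}) (s : seq ((I -> option (option A)) * K)) :
    Prop :=
  uniq (map snd s) /\ List.Forall (focused_line C w) s.

Definition mono_line (I : finType) (C : {ffun I -> option A} -> K) : Prop :=
  exists2 l : I -> option (option A), (exists i, l i = None) &
    forall x y, C (line_at l x) = C (line_at l y).

Lemma line_at_embed (J : finType) (l : J -> option A) x :
  line_at (embed_line l) (Some x) = embed_word (line_at l x).
Proof. by apply/ffunP => j; rewrite !ffunE /embed_line /=; case: (l j). Qed.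

Lemma focused_mono (I : finType) (C : {ffun I -> option A} -> K) w lc :
  focused_line C w lc -> C w = lc.2 -> mono_line C.
Proof.
move=> [ln lw lcE] Cw; exists lc.1 => //.
suff H x : C (line_at lc.1 x) = lc.2 by move=> x y; rewrite !H.
by case: x => [x|]; rewrite ?lw.
Qed.

(* Given a line [l] on the [J]-coordinates along which the colour does not
   depend on the point, a mono line or focused family for the induced colouring
   of the [I]-words lifts to [I + J]-words. *)
Section Lift.
Variables (I J : finType) (C : {ffun I + J -> option A} -> K).
Variables (l : J -> option A) (D : {ffun I -> option A} -> K).
Hypothesis lN : exists j, l j = None.
Hypothesis CD : forall v x, C (join_words v (embed_word (line_at l x))) = D v.

Definition pair_line (m : I -> option (option A)) :
    I + J -> option (option A) :=
  fun s => match s with inl i => m i | inr j => embed_line l j end.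

Lemma pair_line_at m x : line_at (pair_line m) x =
  join_words (line_at m x) (line_at (embed_line l) x).
Proof. by apply/ffunP => -[i|j]; rewrite !ffunE. Qed.

Lemma mono_line_lift : mono_line D -> mono_line C.
Proof.
move=> [m [i mi] Dm].
(* The [J]-coordinates are frozen at one point of [l]; by [CD] the choice of the point does not
   affect the colour. *)
pose m' (s : I + J) := match s with
  | inl i => m i | inr j => Some (embed_word (line_at l a0) j) end.
have m'E x : line_at m' x =
    join_words (line_at m x) (embed_word (line_at l a0)).
  by apply/ffunP => -[k|k]; rewrite [LHS]ffunE [RHS]ffunE /= ?ffunE.
exists m'; first by exists (inl i).
by move=> x y; rewrite !m'E !CD.
Qed.

Lemma focused_line_lift w lc : focused_line D w lc ->
  focused_line C (join_words w (line_at (embed_line l) None))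
    (pair_line lc.1, lc.2).
Proof.
move=> [[i li] lw lcE]; split => /=; first by exists (inl i).
  by rewrite pair_line_at lw.
by move=> x; rewrite pair_line_at line_at_embed CD.
Qed.

(** The additional line of the induction: the [I]-part rests at [w] and only the [J]-part moves, so
    it ends at the same focus as the lines of [focused_line_lift], which move in both parts at
    once. *)
Lemma focus_point_line w :
  focused_line C (join_words w (line_at (embed_line l) None))
    (pair_line (fun i => Some (w i)), D w).
Proof.
have wE x : line_at (fun i => Some (w i)) x = w.
  by apply/ffunP => i; rewrite ffunE.
split => /=.
- by have [j lj] := lN; exists (inr j); rewrite /= /embed_line /= lj.
- by rewrite pair_line_at wE.
- by move=> x; rewrite pair_line_at wE line_at_embed CD.
Qed.

End Lift.

(** Induction on the number [n] of differently coloured lines with a common focus. If the colour of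
    the focus already occurs, the line of that colour closes up to a monochromatic one; otherwise
    the focus itself, moved along [l], provides a line of a new colour. *)
Lemma color_focusing (HA : hales_jewett A) (n : nat) :
  exists I : finType, forall C : {ffun I -> option A} -> K,
    mono_line C \/ exists w s, size s = n /\ focused_family C w s.
Proof.
elim: n => [|n [I IHI]].
  by exists unit => C; right; exists [ffun=> None], [::].
(* The colour of a [J]-word is the whole colouring that it induces on [I]-words. *)
have [J HJ] := HA {ffun {ffun I -> option A} -> K}.
exists (I + J)%type => C.
have [l lN Cl] := HJ (fun w => [ffun v => C (join_words v (embed_word w))]).
pose D v := C (join_words v (embed_word (line_at l a0))).
have CD v x : C (join_words v (embed_word (line_at l x))) = D v.
  by have /ffunP/(_ v) := Cl x a0; rewrite !ffunE.
have [mD|[w [s [sn [us fs]]]]] := IHI D.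
  by left; exact: mono_line_lift mD.
have [Dw|Dw] := boolP (D w \in map snd s).
  left; apply: (mono_line_lift CD).
  elim: s us fs Dw {sn} => //= lc s IHs /andP[_ us].
  move=> /List.Forall_cons_iff[flc fs].
  rewrite inE => /orP[/eqP|Dw]; first exact: focused_mono flc.
  exact: IHs.
right; exists (join_words w (line_at (embed_line l) None)).
exists ((pair_line l (fun i => Some (w i)), D w) ::
        map (fun lc => (pair_line l lc.1, lc.2)) s).
split; first by rewrite /= size_map sn.
split; first by rewrite /= -map_comp; apply/andP.
constructor; first exact: focus_point_line.
apply/List.Forall_map; apply: List.Forall_impl fs => lc.
exact: focused_line_lift.
Qed.

(** There cannot be more differently coloured focused lines than colours. *)
Lemma hales_jewett_option (HA : hales_jewett A) :
  exists I : finType, forall C : {ffun I -> option A} -> K, mono_line C.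
Proof.
have [I HI] := color_focusing HA #|K|.+1; exists I => C.
have [//|[w [s [sn [us _]]]]] := HI C.
have := max_card (mem (map snd s)).
by rewrite (card_uniqP us) size_map sn ltnn.
Qed.

End ColorFocusing.

Theorem hales_jewettP (A : finType) : hales_jewett A.
Proof.
apply: (@hales_jewett_retract 'I_#|A| A (@enum_rank A) (@enum_val A _)).
  exact: enum_rankK.
elim: {A}#|A| => [K|n IHn].
  by exists unit => C; exists (fun=> None); [exists tt|case].
apply: (@hales_jewett_retract (option 'I_n) _ (@unlift n.+1 ord0)
  (fun o => if o is Some i then lift ord0 i else ord0)).
  by move=> i; case: unliftP.
(* Colour focusing needs a letter [a0] in the smaller alphabet, so the one-letter alphabet is
   treated directly. *)
case: n IHn => [_ K|n IHn K]; last exact: hales_jewett_option ord0 IHn.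
by exists unit => C; exists (fun=> None); [exists tt|case=> [[]//|] [[]//|]].
Qed.

(** * Products of ultrafilters and idempotents *)

Lemma proper_setC (T : Type) (F : set_system T) A {FF : ProperFilter F} :
  F A -> ~ F (~` A).
Proof. by move=> FA /(filterI FA) /filter_ex[x []]. Qed.

Lemma ultraP (T : Type) (p : set_system T) : ProperFilter p ->
  (forall A, p A \/ p (~` A)) -> UltraFilter p.
Proof.
move=> pF pC; split=> // G GF pG; apply/seteqP; split=> // A GA.
by have [//|/pG /proper_setC] := pC A; rewrite setCK.
Qed.

Lemma ultra_eq (T : Type) (p q : set_system T) :
  UltraFilter p -> UltraFilter q -> p `<=` q -> p = q.
Proof. by move=> pU qU pq; rewrite (max_filter _ pq). Qed.

Lemma ultra_setC (T : Type) (p : set_system T) A : UltraFilter p ->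
  ~ p A -> p (~` A).
Proof. by move=> pU npA; have [] := in_ultra_setVsetC A pU. Qed.

Lemma filter_seq (T : Type) (I : eqType) (F : set_system T) (s : seq I)
    (A : I -> set T) : Filter F -> (forall i, i \in s -> F (A i)) ->
  F [set x | forall i, i \in s -> A i x].
Proof.
move=> FF; elim: s => [|i s IHs] FA.
  by apply: filterS filterT => x _ i; rewrite in_nil.
have FAs : F [set x | forall j, j \in s -> A j x].
  by apply: IHs => j js; apply: FA; rewrite inE js orbT.
have FAi : F (A i) by apply: FA; rewrite inE eqxx.
apply: filterS (filterI FAi FAs) => x [Aix Asx] j.
by rewrite inE => /orP[/eqP ->|/Asx].
Qed.

(** For filters, this is the filter generated by both; it corresponds to the intersection of two
    closed sets of ultrafilters. *)
Definition filter_join (T : Type) (F G : set_system T) : set_system T :=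
  [set C | exists A B, [/\ F A, G B & A `&` B `<=` C]].

Section FilterJoin.
Context {T : Type} (F G : set_system T) {FF : Filter F} {GF : Filter G}.

Lemma filter_join_proper : F `#` G -> ProperFilter (filter_join F G).
Proof.
move=> FG; apply: Build_ProperFilter_ex.
  by move=> C [A [B [FA GB ABC]]]; have [x /ABC] := FG _ _ FA GB; exists x.
split.
- by exists setT, setT; split => //; exact: filterT.
- move=> C D [A [B [FA GB ABC]]] [A' [B' [FA' GB' ABD]]].
  exists (A `&` A'), (B `&` B'); split; [exact: filterI|exact: filterI|].
  by move=> x [[Ax A'x] [Bx B'x]]; split; [exact: ABC|exact: ABD].
- move=> C D CD [A [B [FA GB ABC]]]; exists A, B; split => //.
  exact: subset_trans CD.
Qed.

Lemma filter_joinl : F `<=` filter_join F G.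
Proof. by move=> A FA; exists A, setT; split => //; exact: filterT. Qed.

Lemma filter_joinr : G `<=` filter_join F G.
Proof. by move=> A GA; exists setT, A; split => //; exact: filterT. Qed.

Lemma filter_joinE (q : set_system T) : Filter q ->
  F `<=` q -> G `<=` q -> filter_join F G `<=` q.
Proof.
move=> qF Fq Gq C [A [B [/Fq qA /Gq qB ABC]]].
exact: filterS ABC (filterI qA qB).
Qed.

End FilterJoin.

(** If [A] is not in [F], then [F] is compatible with the complement of [A], and an ultrafilter
    containing both omits [A]. *)
Lemma filter_ultra_inter (T : Type) (F : set_system T) A : ProperFilter F ->
  (forall p, UltraFilter p -> F `<=` p -> p A) -> F A.
Proof.
move=> FF FA; apply: contrapT => nFA.
have meetFA : F `#` globally (~` A).
  move=> B C FB AC; apply: contrapT => /nonemptyPn BC0; apply: nFA.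
  apply: filterS FB => x Bx; apply: contrapT => nAx.
  by have : (B `&` C) x by [split; last exact: AC]; rewrite BC0.
have [p [pU Fp]] := ultraFilterLemma (filter_join_proper meetFA).
have pA : p A by apply: FA => // B /(@filter_joinl _ F (globally (~` A))) /Fp.
by apply: (proper_setC pA); exact/Fp/filter_joinr.
Qed.

Section Product.
Variables (T : Type) (op : T -> T -> T).

(** The extension of [op] to the Stone-Cech compactification, continuous in [p] for fixed [q]. It is
    defined for all families so that [uprod F p] can describe a closed set translated by [p]. *)
Definition uprod (p q : set_system T) : set_system T :=
  [set A | p [set x | q [set y | A (op x y)]]].

Lemma uprod_filter p q : Filter p -> Filter q -> Filter (uprod p q).
Proof.
move=> pF qF; split.
- by apply: (@filterS _ p) filterT => x _; exact: filterT.
- move=> A B pA pB.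
  apply: (@filterS _ p) (@filterI _ p _ _ _ pA pB) => x [qA qB].
  exact: filterI qA qB.
- move=> A B AB; apply: (@filterS _ p) => x; apply: (@filterS _ q) => y.
  exact: AB.
Qed.

Lemma uprod_proper p q : ProperFilter p -> ProperFilter q ->
  ProperFilter (uprod p q).
Proof.
move=> pF qF; apply: Build_ProperFilter_ex; last exact: uprod_filter.
by move=> A /(@filter_ex _ p)[x /(@filter_ex _ q)[y Axy]]; exists (op x y).
Qed.

Lemma uprod_ultra p q : UltraFilter p -> UltraFilter q ->
  UltraFilter (uprod p q).
Proof.
move=> pU qU; apply: ultraP; first exact: uprod_proper.
move=> A; have [|npA] := pselect (uprod p q A); [by left|right].
apply: (@filterS _ p) (ultra_setC pU npA) => x nqA; exact: ultra_setC nqA.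
Qed.

Lemma uprodA p q r : associative op ->
  uprod p (uprod q r) = uprod (uprod p q) r.
Proof.
move=> opA; apply/funext => A; rewrite /uprod /=.
congr p; apply/funext => x /=; congr q; apply/funext => y /=.
by congr r; apply/funext => z /=; rewrite opA.
Qed.

Lemma uprodSl F G q : F `<=` G -> uprod F q `<=` uprod G q.
Proof. by move=> FG A; exact: FG. Qed.

(** For ultrafilters [p] and [q], this filter encodes the closed set of the solutions [r] of
    [uprod r p = q]. *)
Definition udiv (p q : set_system T) : set_system T :=
  [set B | exists2 A, q A & [set x | p [set y | A (op x y)]] `<=` B].

Lemma udiv_filter p q : Filter p -> Filter q -> Filter (udiv p q).
Proof.
move=> pF qF; split.
- by exists setT => //; exact: filterT.
- move=> B C [A qA AB] [A' qA' AC]; exists (A `&` A'); first exact: filterI.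
  by move=> x pAA'; split; [apply: AB|apply: AC]; apply: filterS pAA' => y [].
- by move=> B C BC [A qA AB]; exists A => //; exact: subset_trans BC.
Qed.

Lemma udivP p q r : UltraFilter p -> UltraFilter q -> UltraFilter r ->
  (udiv p q `<=` r) <-> (uprod r p = q).
Proof.
move=> pU qU rU; split=> [qr|<- B [A rpA AB]].
  2: exact: (@filterS _ r) AB rpA.
apply/esym/ultra_eq; first exact: uprod_ultra.
by move=> A qA; apply: qr; exists A.
Qed.

(* Right multiplication by [p] maps the closed set of ultrafilters containing
   [F] onto the closed set of ultrafilters containing [uprod F p]. *)
Lemma uprod_surj F p q : ProperFilter F -> UltraFilter p -> UltraFilter q ->
  uprod F p `<=` q -> exists r, [/\ UltraFilter r, F `<=` r & uprod r p = q].
Proof.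
move=> FF pU qU Fpq; have GF : Filter (udiv p q) by exact: udiv_filter.
have FG : F `#` udiv p q.
  move=> D B FD [A qA AB]; apply: contrapT => /nonemptyPn DB0.
  (* If [D] and [B] were disjoint, [D] would witness that the complement of [A] is in [uprod F p],
     hence in [q]. *)
  apply: (proper_setC qA); apply: Fpq; apply: filterS FD => x Dx.
  apply: ultra_setC => pA.
  by have : (D `&` B) x by [split; last exact: AB]; rewrite DB0.
have [r [rU FGr]] := ultraFilterLemma (filter_join_proper FG).
exists r; split => //; first by move=> A /(@filter_joinl _ F (udiv p q)) /FGr.
by apply/udivP => // A /(@filter_joinr _ F (udiv p q)) /FGr.
Qed.

(* The closed set of the ultrafilters containing [F] is a subsemigroup. *)
Definition uprod_closed (F : set_system T) : Prop :=
  forall p q, UltraFilter p -> UltraFilter q -> F `<=` p -> F `<=` q ->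
    F `<=` uprod p q.

Section EllisNumakura.
Hypothesis opA : associative op.

Let closed_proper (F : set_system T) := ProperFilter F /\ uprod_closed F.

Lemma maximal_closed_filter (F : set_system T) : ProperFilter F ->
  uprod_closed F -> exists G, [/\ F `<=` G, ProperFilter G, uprod_closed G &
    forall H, G `<=` H -> ProperFilter H -> uprod_closed H -> H = G].
Proof.
move=> FF Fcl.
(* Adjoining [F] lets the empty chain, whose union is empty, satisfy the hypothesis of Zorn's
   lemma. *)
pose P (X : set_system T) := closed_proper (F `|` X).
have [c cP ctot|G [PG Gmax]] := @Zorn_bigcup _ P.
  have [[X0 cX0]|c0] := pselect (exists X, c X); last first.
    have -> : \bigcup_(X in c) X = set0.
      by apply/seteqP; split=> // A [X cX]; case: c0; exists X.
    by rewrite /P setU0.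
  have UE : F `|` \bigcup_(X in c) X = \bigcup_(X in c) (F `|` X).
    apply/seteqP; split=> [A [FA|[X cX XA]]|A [X cX [FA|XA]]].
    - by exists X0 => //; left.
    - by exists X => //; right.
    - by left.
    - by right; exists X.
  rewrite /P UE; split; last first.
    move=> p q pU qU Up Uq A [X cX XA]; have [_ Xcl] := cP _ cX.
    by apply: Xcl XA => // B XB; [apply: Up|apply: Uq]; exists X.
  apply: Build_ProperFilter_ex.
    by move=> A [X cX XA]; have [XF _] := cP _ cX; exact: (@filter_ex _ _ XF).
  split.
  - by exists X0 => //; have [XF _] := cP _ cX0; exact: filterT.
  - move=> A B [X cX XA] [Y cY YB]; have [XF _] := cP _ cX.
    have [YF _] := cP _ cY; have [XY|YX] := ctot _ _ cX cY.
      by exists Y => //; apply: filterI YB; case: XA; [left|right; exact: XY].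
    by exists X => //; apply: filterI XA _; case: YB; [left|right; exact: YX].
  - move=> A B AB [X cX XA]; have [XF _] := cP _ cX; exists X => //.
    exact: filterS XA.
have [GF Gcl] := PG; exists (F `|` G); split => //.
move=> H GH HF Hcl; apply: contrapT => HG; apply: (Gmax H).
  split; last by move=> HG'; apply/HG/seteqP; split=> // A /HG'; right.
  by move=> A GA; apply: GH; right.
rewrite /P (_ : F `|` H = H) //; apply/seteqP; split=> [A [FA|]|A] //.
  by apply: GH; left.
by right.
Qed.

(** A maximal filter [G] is a minimal closed subsemigroup [S]. For [p] in [S], minimality gives
    [S p = S]; hence the [q] in [S] with [q p = p] form a nonempty closed subsemigroup, which by
    minimality is [S] and so contains [p]. *)
Theorem ellis_numakura (F : set_system T) : ProperFilter F ->
  uprod_closed F -> exists p, [/\ UltraFilter p, F `<=` p & uprod p p = p].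
Proof.
move=> /maximal_closed_filter /[apply] -[G [FG GF Gcl Gmax]].
have [p [pU Gp]] := ultraFilterLemma GF.
exists p; split=> //; first exact: subset_trans Gp.
have GpE : uprod G p = G.
  apply: Gmax; last 2 first.
  - exact: uprod_proper.
  - move=> q1 q2 q1U q2U /uprod_surj[r1 [r1U Gr1 <-]].
    move=> /uprod_surj[r2 [r2U Gr2 <-]].
    rewrite uprodA //; apply: uprodSl.
    exact: (Gcl _ _ (uprod_ultra r1U pU) r2U (Gcl _ _ r1U pU Gr1 Gp)).
  move=> A GA; apply: (@filter_ultra_inter _ G) => q qU Gq.
  exact: (Gcl q p qU pU Gq Gp A GA).
have [q [qU Gq qp]] : exists q, [/\ UltraFilter q, G `<=` q & uprod q p = p].
  by apply: uprod_surj; rewrite ?GpE.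
have dF : Filter (udiv p p) by exact: udiv_filter.
pose H := filter_join G (udiv p p).
have GH : G `<=` H by exact: filter_joinl.
have HP r : UltraFilter r -> H `<=` r -> uprod r p = p.
  by move=> rU Hr; apply/udivP => // A /(@filter_joinr _ G (udiv p p)) /Hr.
suff HG : H = G by apply: HP => //; rewrite HG.
have dq : udiv p p `<=` q by exact/udivP.
have HF : ProperFilter H.
  apply: filter_join_proper => A B /Gq qA /dq qB.
  exact: filter_ex (filterI qA qB).
apply: Gmax => // r1 r2 r1U r2U Hr1 Hr2.
have r12U := uprod_ultra r1U r2U.
apply: filter_joinE.
  by apply: Gcl => // A /GH; [exact: Hr1|exact: Hr2].
by apply/udivP; rewrite // -uprodA // !HP.
Qed.

(* For an arbitrary family [G], the ultrafilters contained in [G] form a closed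
   set, namely that of the ultrafilters containing the filter [F] below. *)
Corollary idempotent_ultra_in (G : set_system T) :
  (exists2 p, UltraFilter p & p `<=` G) ->
  (forall p q, UltraFilter p -> UltraFilter q -> p `<=` G -> q `<=` G ->
    uprod p q `<=` G) ->
  exists p, [/\ UltraFilter p, p `<=` G & uprod p p = p].
Proof.
move=> [p0 p0U p0G] Gcl.
pose F := [set A | forall p, UltraFilter p -> p `<=` G -> p A].
have FG q : UltraFilter q -> F `<=` q -> q `<=` G.
  move=> qU Fq A qA; apply: contrapT => nGA; apply: (proper_setC qA); apply: Fq.
  by move=> p pU pG; apply: ultra_setC => /pG.
have FF : ProperFilter F.
  apply: Build_ProperFilter_ex.
    by move=> A FA; apply: (@filter_ex _ p0); exact: FA.
  split.
  - by move=> p pU _; exact: filterT.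
  - by move=> A B FA FB p pU pG; apply: filterI; [exact: FA|exact: FB].
  - by move=> A B AB FA p pU pG; exact: filterS AB (FA p pU pG).
have [|p [pU /FG pG pp]] := ellis_numakura FF.
  2: by exists p; split=> //; exact: pG.
move=> p q pU qU /FG pG /FG qG A; apply; first exact: uprod_ultra.
by apply: Gcl.
Qed.

End EllisNumakura.
End Product.

(** * J-sets *)

(* Instantiated by [Q = omega], [P = N] for addition and [Q = P = N] for
   multiplication; only the elements of [P] may be used as variables, while a
   row of zeroes takes the value [e], which lies in [Q]. *)
Record ideal_in (T : Type) (e : T) (op : T -> T -> T) (Q P : set T) : Prop := {
  ideal_one : Q e;
  ideal_mul : forall x y, Q x -> Q y -> Q (op x y);
  ideal_sub : P `<=` Q;
  ideal_ne : P !=set0;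
  ideal_mulr : forall x y, P x -> Q y -> P (op x y)
}.

Section JSets.
Variables (T : eqType) (e : T) (op : Monoid.com_law e) (Q P : set T).
Hypothesis QP : ideal_in e op Q P.

(** The translation [a] is required to be in [P] because it will be the value of a variable, while
    the sequences may take any values in [Q]. *)
Definition J_set (A : set T) : Prop :=
  forall (I : finType) (f : I -> nat -> T), (forall i t, Q (f i t)) ->
    exists a H, [/\ P a, H != [::], uniq H &
      forall i, A (op a (\big[op/e]_(t <- H) f i t))].

Lemma ideal_big (I : eqType) (s : seq I) (F : I -> T) :
  (forall i, i \in s -> Q (F i)) -> Q (\big[op/e]_(i <- s) F i).
Proof.
move=> QF; rewrite big_seq; apply: big_ind; first exact: ideal_one QP.
  exact: ideal_mul QP.
by move=> i /QF.
Qed.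

Lemma J_setS A B : A `<=` B -> J_set A -> J_set B.
Proof.
move=> AB JA I f /JA [a [H [Pa H0 uH Af]]]; exists a, H; split => // i.
exact: AB.
Qed.

Lemma J_set_ideal : J_set P.
Proof.
move=> I f Qf; have [a Pa] := ideal_ne QP; exists a, [:: 0]; split => // i.
by apply: ideal_mulr QP _ _ Pa _; apply: ideal_big.
Qed.

Lemma J_set_meet A : J_set A -> (A `&` P) !=set0.
Proof.
move=> JA; have Qe := ideal_one QP.
have [a [H [Pa _ _ /(_ tt) Aa]]] := JA unit (fun _ _ => e) (fun _ _ => Qe).
by move: Aa; rewrite big1 // Monoid.mulm1 => Aa; exists a.
Qed.

(** Let [f] and [g] be families showing that [A] and [B] are not J-sets. Words over their disjoint
    union of indices define sequences to which the J-property of the union applies; colour the words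
    by membership in [A]. On a monochromatic line the fixed letters are absorbed into the
    translation, and the moving ones give a finite set serving all of [f] and [g]. *)
Lemma J_setU A B : J_set (A `|` B) -> J_set A \/ J_set B.
Proof.
move=> JAB; have [|nJA] := pselect (J_set A); [by left|right].
have [|nJB] := pselect (J_set B); [by []|exfalso].
have noJ C : ~ J_set C -> exists (I : finType) (f : I -> nat -> T),
    (forall i t, Q (f i t)) /\ forall a H, P a -> H != [::] -> uniq H ->
      ~ forall i, C (op a (\big[op/e]_(t <- H) f i t)).
  move=> nJC; apply: contrapT => nf; apply: nJC => I f Qf.
  apply: contrapT => naH; apply: nf; exists I, f; split => // a H Pa H0 uH Cf.
  by apply: naH; exists a, H.
have [I [f [Qf nf]]] := noJ _ nJA; have [J [g [Qg ng]]] := noJ _ nJB.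
pose h (k : I + J) := match k with inl i => f i | inr j => g j end.
have Qh k t : Q (h k t) by case: k => k; [exact: Qf|exact: Qg].
have [N HN] := @hales_jewettP (I + J)%type bool.
(* An injective coding of pairs, so that no time is used twice in [H']. *)
pose idx (t : nat) (n : N) := t * #|N| + enum_rank n.
have idx_inj t t' n n' : idx t n = idx t' n' -> t = t' /\ n = n'.
  move=> E; have N0 : 0 < #|N| by apply/card_gt0P; exists n.
  have tt' : t = t'.
    have := congr1 (divn^~ #|N|) E; rewrite /idx !divnMDl //.
    by rewrite !divn_small ?addn0.
  split => //; apply: (@enum_rank_inj N); apply: val_inj.
  by move: E; rewrite /idx tt' => /addnI.
pose hw (w : {ffun N -> I + J}) t := \big[op/e]_n h (w n) (idx t n).
have [a [H [Pa H0 uH ABw]]] : exists a H, [/\ P a, H != [::], uniq H &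
    forall w, (A `|` B) (op a (\big[op/e]_(t <- H) hw w t))].
  by apply: JAB => w t; rewrite /hw; apply: ideal_big.
have [l [n0 ln0] Cl] :=
  HN (fun w => `[< A (op a (\big[op/e]_(t <- H) hw w t)) >]).
pose b := \big[op/e]_(t <- H) \big[op/e]_(n | l n != None)
  (if l n is Some k then h k (idx t n) else e).
pose H' := [seq idx t n | t <- H, n <- enum [pred n | l n == None]].
have Qb : Q b.
  apply: ideal_big => t _; rewrite -big_filter; apply: ideal_big => n _.
  by case: (l n) => // ; exact: ideal_one QP.
have Pab : P (op a b) by exact: ideal_mulr QP _ _ Pa Qb.
have H'0 : H' != [::].
  case: H H0 @H' {uH ABw Cl b Qb Pab} => // t H _ /=.
  rewrite -size_eq0 size_cat size_map -cardE; apply/eqP => /eqP.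
  rewrite addn_eq0 => /andP[/eqP/card0_eq/(_ n0)].
  by rewrite inE ln0.
have uH' : uniq H'.
  apply: allpairs_uniq => //; first exact: enum_uniq.
  by move=> [t n] [t' n'] _ _ /= /idx_inj[-> ->].
have lineE k : op a (\big[op/e]_(t <- H) hw (line_at l k) t) =
    op (op a b) (\big[op/e]_(t <- H') h k t).
  rewrite -Monoid.mulmA; congr (op a _).
  rewrite big_allpairs_dep /= -big_split /=; apply: eq_bigr => t _.
  rewrite /hw (bigID (fun n => l n != None)) /=; congr (op _ _).
    by apply: eq_bigr => n; rewrite ffunE; case: (l n).
  rewrite big_enum /=; apply: eq_big => [n|n]; first by rewrite negbK.
  by rewrite negbK ffunE => /eqP ->.
(* One point of the line in [A] puts the whole line in [A], contradicting [nf]; otherwise the line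
   is in [B], contradicting [ng]. *)
have [Ak|nAk] :=
  pselect (exists k, A (op (op a b) (\big[op/e]_(t <- H') h k t))).
  have [k Ak'] := Ak; apply: (nf (op a b) H') => // i.
  by move/asboolP: Ak'; rewrite -lineE (Cl k (inl i)) lineE => /asboolP.
apply: (ng (op a b) H') => // j; have := ABw (line_at l (inr j)).
by rewrite lineE => -[Aj|//]; case: nAk; exists (inr j).
Qed.

(** By partition regularity the sets whose complement is not a J-set form a filter; any ultrafilter
    extending it will do. *)
Lemma J_ultra_exists : exists2 p, UltraFilter p & p `<=` J_set.
Proof.
pose F := [set A | ~ J_set (~` A)].
have F0 : ~ J_set set0 by move=> /J_set_meet [x []].
have FF : ProperFilter F.
  apply: Build_ProperFilter_ex.
    move=> A FA; apply: contrapT => /nonemptyPn A0; apply: FA.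
    by apply: J_setS J_set_ideal => x _ Ax; rewrite A0 in Ax.
  split.
  - by rewrite /F /= setCT.
  - by move=> A B FA FB; rewrite /F /= setCI => /J_setU[].
  - by move=> A B AB FA /J_setS JB; apply/FA/JB; exact: subsetC.
have [p [pU Fp]] := ultraFilterLemma FF; exists p => // A pA.
apply: contrapT => nJA; apply: (proper_setC pA); apply: Fp.
by rewrite /F /= setCK.
Qed.

Lemma J_ultra_ideal p : UltraFilter p -> p `<=` J_set -> p P.
Proof.
move=> pU pJ; apply: contrapT => /ultra_setC /pJ /J_set_meet [x []] //.
Qed.

(** A single [x] in [Q] whose associated section of [A] is a J-set suffices: it is absorbed into the
    translation. *)
Lemma J_ultra_uprodr p q : UltraFilter p -> p Q -> q `<=` J_set ->
  uprod op p q `<=` J_set.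
Proof.
move=> pU pQ qJ A pqA.
have [x [Qx /qJ Jx]] := filter_ex (filterI pQ pqA).
move=> I f /Jx [a [H [Pa H0 uH Af]]]; exists (op a x), H; split => //.
  exact: ideal_mulr QP _ _ Pa Qx.
by move=> i; rewrite [op a x]Monoid.mulmC -Monoid.mulmA; exact: Af.
Qed.

(** The finitely many conditions on the right factor hold on members of [q], so they have a common
    solution [y] in [Q], which is absorbed into the translation. *)
Lemma J_ultra_uprodl p q : UltraFilter q -> q Q -> p `<=` J_set ->
  uprod op p q `<=` J_set.
Proof.
move=> qU qQ pJ A /pJ Jp I f /Jp [a [H [Pa H0 uH Af]]].
pose B i := [set y | A (op (op a (\big[op/e]_(t <- H) f i t)) y)].
have qB : q [set y | forall i, i \in enum I -> B i y].
  by apply: filter_seq => i _; exact: Af.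
have [y [Qy By]] := filter_ex (filterI qQ qB).
exists (op a y), H; split => //; first exact: ideal_mulr QP _ _ Pa Qy.
by move=> i; rewrite Monoid.mulmAC; apply: By; rewrite mem_enum.
Qed.

End JSets.

(** * Images of matrices in members of idempotents *)

Fixpoint monic_row (r : seq nat) : bool :=
  if r is a :: r' then (a == 1) || (a == 0) && monic_row r' else false.

Section Images.
Variables (T : eqType) (e : T) (op : Monoid.com_law e) (Q P : set T).
Hypothesis QP : ideal_in e op Q P.

Definition op_exp (x : T) (n : nat) : T := iter n (op x) e.

Definition dot (r : seq nat) (x : nat -> T) : T :=
  \big[op/e]_(j < size r) op_exp (x j) (nth 0 r j).

Lemma op_exp_big (I : Type) (s : seq I) (F : I -> T) n :
  op_exp (\big[op/e]_(i <- s) F i) n = \big[op/e]_(i <- s) op_exp (F i) n.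
Proof.
elim: n => [|n IHn]; first by rewrite [RHS]big1.
by rewrite /op_exp /= -/(op_exp _ n) IHn -big_split.
Qed.

Lemma dot_cons a r x : dot (a :: r) x = op (op_exp (x 0) a) (dot r (x \o S)).
Proof. by rewrite /dot /= big_ord_recl. Qed.

Lemma dot_big (I : Type) (s : seq I) (xs : I -> nat -> T) r :
  dot r (fun j => \big[op/e]_(i <- s) xs i j) =
  \big[op/e]_(i <- s) dot r (xs i).
Proof.
by rewrite /dot exchange_big /=; apply: eq_bigr => j _; rewrite op_exp_big.
Qed.

Lemma dot_ideal r x : (forall j, Q (x j)) -> Q (dot r x).
Proof.
move=> Qx; apply: (ideal_big QP) => j _.
elim: (nth 0 r j) => [|n IHn]; first exact: ideal_one QP.
exact: ideal_mul QP _ _ (Qx j) IHn.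
Qed.

Lemma ideal_big_pos (I : eqType) (s : seq I) (F : I -> T) : s != [::] ->
  (forall i, P (F i)) -> P (\big[op/e]_(i <- s) F i).
Proof.
case: s => // i s _ PF; rewrite big_cons; apply: ideal_mulr QP _ _ (PF i) _.
by apply: (ideal_big QP) => k _; exact: ideal_sub QP _ (PF k).
Qed.

(* Galvin's argument: if [B] is in the idempotent [p], so is
   [B* = {z in B | -z + B in p}]; the values at stage [n] are taken in [B*] and
   then [B] is shrunk so that the later sums can be added to them. *)
Lemma galvin_sequence (p : set_system T) (B : set T) (X : Type)
    (R : nat -> X -> seq T) : UltraFilter p -> uprod op p p = p -> p B ->
  (forall n C, p C -> exists x, forall c, c \in R n x -> C c) ->
  exists x : nat -> X, forall (H : seq nat) (c : nat -> T),
    H != [::] -> uniq H -> (forall t, t \in H -> c t \in R t (x t)) ->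
    B (\big[op/e]_(t <- H) c t).
Proof.
move=> pU pp pB RX.
pose star C := [set z | C z /\ p [set y | C (op z y)]].
have pstar C : p C -> p (star C).
  by move=> pC; apply: filterI => //; rewrite -pp in pC.
have [pick pickP] : exists pick : nat -> {C | p C} -> X,
    forall n C c, c \in R n (pick n C) -> star (sval C) c.
  have H n (C : {C | p C}) : exists x, forall c, c \in R n x -> star (sval C) c.
    by apply: RX; apply: pstar; exact: svalP C.
  exists (fun n C => projT1 (cid (H n C))) => n C.
  exact: projT2 (cid (H n C)).
pose next n (C : set T) x :=
  C `&` [set y | forall c, c \in R n x -> C (op c y)].
have pnext n (C : {C | p C}) : p (next n (sval C) (pick n C)).
  apply: filterI; first exact: svalP C.
  by apply: filter_seq => c /pickP[].
pose st := fix st n : {C | p C} := if n is m.+1 then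
  exist _ _ (pnext m (st m)) else exist _ B pB.
exists (fun n => pick n (st n)).
have st_mono m n : m <= n -> sval (st n) `<=` sval (st m).
  move=> /subnK <-; elim: (n - m) => // k IHk y [/IHk //].
(* For increasing [H] with first index [t], the sum over the tail is in the set of stage [t.+1],
   which by the definition of [next] allows [c t] to be added. *)
have main H c m : H != [::] -> sorted ltn H -> all (leq m) H ->
    (forall t, t \in H -> c t \in R t (pick t (st t))) ->
    sval (st m) (\big[op/e]_(t <- H) c t).
  elim: H m => // t H IHH m _ sH /= /andP[mt mH] cR.
  have [Sct _] : star (sval (st t)) (c t).
    by apply: pickP; apply: cR; rewrite inE eqxx.
  apply: (st_mono _ _ mt); rewrite big_cons.
  have [->|H0] := eqVneq H [::]; first by rewrite big_nil Monoid.mulm1.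
  have [|_] := IHH t.+1 H0 (path_sorted sH) (order_path_min ltn_trans sH) _.
    by move=> u uH; apply: cR; rewrite inE uH orbT.
  by apply; apply: cR; rewrite inE eqxx.
move=> H c H0 uH cR; rewrite -(perm_big _ (permEl (perm_sort leq H))) /=.
apply: (main _ c 0).
- by rewrite -size_eq0 size_sort size_eq0.
- rewrite ltn_sorted_uniq_leq sort_uniq uH.
  by apply: sort_sorted; exact: leq_total.
- by apply/allP.
- by move=> t; rewrite mem_sort => /cR.
Qed.

(** Induction on the number of columns. Galvin's argument yields vectors [xs t] such that the rows
    beginning with 0 take values in [B] on every finite sum of them. The J-property then selects a
    first coordinate [a] and one such sum that also serve the rows beginning with 1. *)
Lemma monic_rows_image (p : set_system T) : UltraFilter p ->
    uprod op p p = p -> p `<=` J_set op Q P ->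
  forall (L : seq (seq nat)), (forall r, r \in L -> monic_row r) ->
  forall B, p B -> exists2 x : nat -> T, forall j, P (x j) &
    forall r, r \in L -> B (dot r x).
Proof.
move=> pU pp pJ L.
have [k] : exists k, forall r, r \in L -> size r <= k.
  exists (\max_(r <- L) size r) => r rL; exact: leq_bigmax_seq.
elim: k L => [|k IHk] L Lk Lm B pB.
  have [a Pa] := ideal_ne QP; exists (fun=> a) => // r rL.
  by have := Lk r rL; have := Lm r rL; case: r {rL}.
pose L0 := [seq behead r | r <- L & head 0 r == 0].
pose L1 := [seq behead r | r <- L & head 0 r == 1].
have L0P r : r \in L0 -> size r <= k /\ monic_row r.
  move=> /mapP[s]; rewrite mem_filter => /andP[s0 sL] ->.
  have := Lk s sL; have := Lm s sL; case: s s0 {sL} => //= a s /eqP ->.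
  by rewrite eqxx.
pose X := {x : nat -> T | forall j, P (x j)}.
have [xs xsP] : exists xs : nat -> X, forall (H : seq nat) (c : nat -> T),
    H != [::] -> uniq H ->
    (forall t, t \in H -> c t \in [seq dot r (sval (xs t)) | r <- L0]) ->
    B (\big[op/e]_(t <- H) c t).
  apply: (@galvin_sequence p B X
    (fun _ x => [seq dot r (sval x) | r <- L0])) => //.
  move=> _ C pC; have [|r /L0P[]//|x Px Cx] := IHk L0 _ _ C pC.
    by move=> r /L0P[].
  by exists (exist _ x Px) => _ /mapP[r rL ->]; exact: Cx.
have Qxs t j : Q (sval (xs t) j).
  by apply: ideal_sub QP _ _; exact: svalP (xs t) j.
pose f (i : 'I_(size L1)) t := dot (nth [::] L1 i) (sval (xs t)).
have [a [H [Pa H0 uH Bf]]] : exists a H, [/\ P a, H != [::], uniq H &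
    forall i, B (op a (\big[op/e]_(t <- H) f i t))].
  by apply: (pJ _ pB) => i t; apply: dot_ideal.
exists (fun j => if j is j'.+1 then \big[op/e]_(t <- H) sval (xs t) j' else a).
  by case=> // j; apply: ideal_big_pos => // t; exact: svalP (xs t) j.
move=> [|b r] rL; first by have := Lm _ rL.
rewrite dot_cons /comp /= dot_big.
have [/eqP b1|/andP[/eqP b0 _]] := orP (Lm _ rL : (b == 1) || _); subst b.
  have rL1 : r \in L1.
    by apply/mapP; exists (1 :: r); rewrite // mem_filter.
  have iL : index r L1 < size L1 by rewrite index_mem.
  have := Bf (Ordinal iL); rewrite /f /= nth_index // /op_exp /=.
  by rewrite Monoid.mulm1.
rewrite Monoid.mul1m; apply: xsP => // t _.
by apply: map_f; apply/mapP; exists (0 :: r); rewrite // mem_filter.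
Qed.

(** Galvin's argument with the image of the [n]-th segment as stage [n]: a row of the whole matrix
    combines rows of finitely many segments. *)
Lemma monic_segments_image (p : set_system T) (L : nat -> seq (seq nat)) B :
    UltraFilter p -> uprod op p p = p -> p `<=` J_set op Q P -> p B ->
    (forall n r, r \in L n -> monic_row r) ->
  exists2 xs : nat -> nat -> T, forall n j, P (xs n j) &
    forall (H : seq nat) (c : nat -> seq nat), H != [::] -> uniq H ->
      (forall n, n \in H -> c n \in L n) ->
      B (\big[op/e]_(n <- H) dot (c n) (xs n)).
Proof.
move=> pU pp pJ pB Lm.
pose X := {x : nat -> T | forall j, P (x j)}.
have [n C pC|xs xsP] := @galvin_sequence p B X
    (fun n x => [seq dot r (sval x) | r <- L n]) pU pp pB.
  have [x Px Cx] := monic_rows_image pU pp pJ (Lm n) pC.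
  by exists (exist _ x Px) => _ /mapP[r rL ->]; exact: Cx.
exists (fun n => sval (xs n)) => [n|H c H0 uH cL]; first exact: svalP (xs n).
by apply: xsP => // n /cL cn; apply: map_f.
Qed.

End Images.

(** * Segmented matrices *)

Lemma monic_rowP (r : seq nat) :
  (exists2 j, j < size r & nth 0 r j != 0) ->
  (forall j, j < size r -> nth 0 r j != 0 ->
    (forall k, k < j -> nth 0 r k = 0) -> nth 0 r j = 1) ->
  monic_row r.
Proof.
elim: r => [[]//|a r IHr] [j jr aj] Hr /=.
have [a0|an0] := eqVneq a 0; last first.
  by have -> : a = 1 by exact: (Hr 0).
rewrite a0 /=; apply: IHr => [|i ir ri rk].
  by case: j jr aj => [_|j jr rj]; [rewrite /= a0|exists j].
by apply: (Hr i.+1) => // -[|k] //=; exact: rk.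
Qed.

Section Blocks.
Variable alpha : nat -> nat.
Hypothesis alpha_incr : {homo alpha : m n / m < n}.
Hypothesis alpha0 : alpha 0 = 0.

Definition block (a : nat -> nat) (n : nat) : seq nat :=
  mkseq (fun j => a (alpha n + j)) (alpha n.+1 - alpha n).

Lemma alpha_mono m n : m <= n -> alpha m <= alpha n.
Proof. by rewrite leq_eqVlt => /predU1P[->//|/alpha_incr/ltnW]. Qed.

Lemma alpha_ge n : n <= alpha n.
Proof. by elim: n => // n IHn; apply: leq_ltn_trans IHn (alpha_incr _). Qed.

Lemma block_index m : exists n, alpha n <= m < alpha n.+1.
Proof.
elim: m => [|m [n /andP[nm mn]]].
  by exists 0; rewrite alpha0 /= -{1}alpha0; exact: alpha_incr.
move: mn; rewrite leq_eqVlt => /predU1P[->|mn].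
  by exists n.+1; rewrite leqnn; exact: alpha_incr.
by exists n; rewrite mn leqW.
Qed.

Lemma block_index_uniq m n n' : alpha n <= m < alpha n.+1 ->
  alpha n' <= m < alpha n'.+1 -> n = n'.
Proof.
move=> /andP[nm mn] /andP[nm' mn']; apply/eqP; rewrite eqn_leq.
have key k l : alpha k <= m -> m < alpha l.+1 -> k <= l.
  move=> km ml; rewrite leqNgt; apply/negP => /alpha_mono lk.
  by have := leq_trans ml (leq_trans lk km); rewrite ltnn.
by rewrite (key _ _ nm mn') (key _ _ nm' mn).
Qed.

Lemma glue_blocks (T : Type) (P : set T) (xs : nat -> nat -> T) :
  (forall n j, P (xs n j)) -> exists2 x : nat -> T, forall j, P (x j) &
    forall n j, j < alpha n.+1 - alpha n -> x (alpha n + j) = xs n j.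
Proof.
move=> Pxs; have [b bP] := choice block_index.
exists (fun m => xs (b m) (m - alpha (b m))) => // n j jn.
rewrite (@block_index_uniq (alpha n + j) (b (alpha n + j)) n) //.
  by rewrite addKn.
by rewrite leq_addr /= -ltn_subRL.
Qed.

Section Product.
Variables (T : Type) (e : T) (op : Monoid.com_law e).

Lemma big_blocks (F : nat -> T) N : \big[op/e]_(j < alpha N) F j =
  \big[op/e]_(n < N) \big[op/e]_(j < alpha n.+1 - alpha n) F (alpha n + j).
Proof.
elim: N => [|N IHN]; first by rewrite alpha0 !big_ord0.
rewrite big_ord_recr -IHN -!(big_mkord xpredT F) /=.
rewrite (big_cat_nat (leq0n _) (alpha_mono (leqnSn N))) /=; congr (op _ _).
rewrite -{1}[alpha N]add0n big_addn big_mkord.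
by apply: eq_bigr => j _; rewrite addnC.
Qed.

End Product.

(** Blocks of zeroes contribute [e] and are dropped, because [monic_segments_image] admits only
    monic rows. *)
Lemma fsbig_blocks (T : eqType) (e : T) (op : Monoid.com_law e)
    (a : nat -> nat) (x : nat -> T) (xs : nat -> nat -> T) N :
  (forall n j, j < alpha n.+1 - alpha n -> x (alpha n + j) = xs n j) ->
  (forall j, a j != 0 -> j < alpha N) ->
  \big[op/e]_(j \in [set: nat]) op_exp op (x j) (a j) =
  \big[op/e]_(n <- [seq n <- iota 0 N | has (predC1 0) (block a n)])
    dot op (block a n) (xs n).
Proof.
move=> xE aN; rewrite -(fsbig_widen `I_(alpha N)) //; last first.
  move=> j [_ /= /negP Nj]; have [->//|/aN jN] := eqVneq (a j) 0.
  by rewrite jN in Nj.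
rewrite -fsbig_ord (big_blocks op (fun j => op_exp op (x j) (a j))).
rewrite -(big_mkord xpredT (fun n => \big[op/e]_(j < alpha n.+1 - alpha n)
  op_exp op (x (alpha n + j)) (a (alpha n + j)))) /index_iota subn0 big_filter.
rewrite [RHS]big_mkcond; apply: eq_bigr => n _.
transitivity (dot op (block a n) (xs n)).
  rewrite /dot size_mkseq; apply: eq_bigr => j _.
  by rewrite nth_mkseq // xE.
case: ifPn => // /hasPn a0; rewrite /dot big1 // => j _.
by have := a0 _ (mem_nth 0 (ltn_ord j)); rewrite negbK => /eqP ->.
Qed.

End Blocks.

(** The finite matrix given for a segment serves only to bound the number of distinct nonzero
    blocks: each of its rows is traced back to a row of [A], so the lists have entries in [nat]. *)
Lemma msfe_blocks (A : nat -> nat -> nat) :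
    monic_segmented_first_entries (fun i j => ((A i j)%:R : rat)%R) ->
  exists (alpha : nat -> nat) (L : nat -> seq (seq nat)),
    [/\ {homo alpha : m n / m < n}, alpha 0 = 0,
        forall n r, r \in L n -> monic_row r &
        forall n i, has (predC1 0) (block alpha (A i) n) ->
          block alpha (A i) n \in L n].
Proof.
case=> _ _ [alpha [alphaS alpha0 HS]]; exists alpha.
pose Ar i j : rat := ((A i j)%:R)%R.
pose sg n i := segment Ar (alpha n) (alpha n.+1) i.
have sgE n i (j : 'I_(alpha n.+1 - alpha n)) :
    sg n i 0%R j = ((nth 0 (block alpha (A i) n) j)%:R)%R.
  by rewrite mxE nth_mkseq.
have sg_inj n i i' : sg n i = sg n i' ->
    block alpha (A i) n = block alpha (A i') n.
  move=> E; apply: (@eq_from_nth _ 0); rewrite !size_mkseq // => j jn.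
  apply/eqP; rewrite -(@Num.Theory.eqr_nat rat).
  by rewrite -!(sgE n _ (Ordinal jn)) E.
have sg_neq0 n i : has (predC1 0) (block alpha (A i) n) -> sg n i <> 0%R.
  move=> /(has_nthP 0)[j]; rewrite size_mkseq => jn /negP bj s0; apply: bj.
  by rewrite -(@Num.Theory.eqr_nat rat) -(sgE n i (Ordinal jn)) s0 mxE.
have Lex n : exists L : seq (seq nat), (forall r, r \in L -> monic_row r) /\
    forall i, has (predC1 0) (block alpha (A i) n) -> block alpha (A i) n \in L.
  have [SM S1] := HS n.
  case: SM => [S0|[u [M [_ SM]]]].
    exists [::]; split=> // i /sg_neq0 sgi.
    have : @nonzero_segments Ar (alpha n) (alpha n.+1) (sg n i).
      by split => //; exists i.
    by rewrite S0.
  have rowS k : exists i, sg n i = row k M /\ row k M <> 0%R.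
    have [[i _ <-] s0] : @nonzero_segments Ar (alpha n) (alpha n.+1) (row k M).
      by rewrite SM; exists k.
    by exists i.
  have [i_ i_P] := choice rowS.
  exists [seq block alpha (A (i_ k)) n | k <- enum 'I_u]; split.
    move=> _ /mapP[k _ ->]; have [ik rk0] := i_P k.
    apply: monic_rowP.
      apply: contrapT => H; apply: rk0; rewrite -ik; apply/rowP => j.
      rewrite sgE mxE; set b := nth _ _ _; have [->//|nj] := eqVneq b 0.
      by case: H; exists j => //; rewrite size_mkseq.
    rewrite size_mkseq => j jn nj nk; apply/eqP.
    rewrite -(@Num.Theory.eqr_nat rat) -(sgE n _ (Ordinal jn)) ik; apply/eqP.
    apply: S1; first by rewrite SM; exists k.
    rewrite -ik; split; first by rewrite sgE (@Num.Theory.pnatr_eq0 rat).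
    by move=> l lj; rewrite sgE nk.
  move=> i /sg_neq0 sgi.
  have : @nonzero_segments Ar (alpha n) (alpha n.+1) (sg n i).
    by split => //; exists i.
  rewrite SM => -[k _ Ek]; apply/mapP; exists k; first by rewrite mem_enum.
  by apply: sg_inj; have [-> _] := i_P k.
have [L LP] := choice Lex; exists L.
by split=> // n; have [] := LP n.
Qed.

Lemma msfe_image (A : nat -> nat -> nat)
    (hA : monic_segmented_first_entries (fun i j => ((A i j)%:R : rat)%R))
    (T : eqType) (e : T) (op : Monoid.com_law e) (Q P : set T)
    (QP : ideal_in e op Q P) (p : set_system T) (B : set T) :
  UltraFilter p -> uprod op p p = p -> p `<=` J_set op Q P -> p B ->
  exists2 x : nat -> T, forall j, P (x j) &
    forall i, B (\big[op/e]_(j \in [set: nat]) op_exp op (x j) (A i j)).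
Proof.
move=> pU pp pJ pB; have [alpha [L [alphaS alpha0 Lm AL]]] := msfe_blocks hA.
have [xs Pxs Bxs] := monic_segments_image QP pU pp pJ pB Lm.
have [x Px xE] := glue_blocks alphaS alpha0 Pxs.
exists x => // i.
have [N AN] : exists N, forall j, A i j != 0 -> j < alpha N.
  have /finite_seqP[X XE] := msfe_row_finite hA i.
  exists (\max_(j <- X) j).+1 => j Aij.
  have jX : j \in X.
    have : [set j | ((A i j)%:R != 0 :> rat)%R] j.
      by rewrite /= Num.Theory.pnatr_eq0.
    by rewrite XE.
  apply: leq_trans (alpha_ge alphaS _); rewrite ltnS.
  exact: (@leq_bigmax_seq _ _ xpredT id).
rewrite (fsbig_blocks alphaS alpha0 op xE AN); apply: Bxs.
(* The set of contributing segments is nonempty: it contains the segment of a nonzero entry. *)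
- have [j] := msfe_row_neq0 hA i; rewrite Num.Theory.pnatr_eq0 => Aij.
  have [n /andP[nj jn]] := block_index alphaS alpha0 j.
  rewrite -has_filter; apply/hasP; exists n.
    rewrite mem_iota /= add0n ltnNge; apply/negP => /(alpha_mono alphaS).
    by move=> /leq_trans /(_ nj); rewrite leqNgt AN.
  apply/hasP; exists (A i j) => //; apply/mapP; exists (j - alpha n).
    by rewrite mem_iota add0n /= ltn_sub2r // (leq_ltn_trans nj).
  by rewrite subnKC.
- by rewrite filter_uniq // iota_uniq.
- by move=> n; rewrite mem_filter => /andP[/AL].
Qed.

(** * Combining addition and multiplication *)

Lemma omega_mulvE A x k :
  omega_mulv A x k = \big[addn/0]_(j \in [set: nat]) op_exp addn (x j) (A k j).
Proof.
rewrite /omega_mulv; apply: eq_fsbigr => j _.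
by rewrite /op_exp iter_addn_0 mulnC.
Qed.

Lemma omega_expvE y A k :
  omega_expv y A k = \big[muln/1]_(j \in [set: nat]) op_exp muln (y j) (A k j).
Proof.
by rewrite /omega_expv; apply: eq_fsbigr => j _; rewrite /op_exp iter_muln_1.
Qed.

Lemma omega_mulv_scale A n x k :
  omega_mulv A (fun j => n * x j) k = n * omega_mulv A x k.
Proof.
rewrite /omega_mulv; under eq_fsbigr do rewrite mulnCA.
case: n => [|n]; first by rewrite fsbig1.
case: (pselect (finite_set ([set: nat] `&`
    (fun j => A k j * x j) @^-1` [set~ 0]))) => [finA|infA].
  by rewrite (full_fsbig_distrr addn).
(* With infinite support both sums take the default value 0; the nonzero factor does not change the
   support. *)
rewrite !fsbig_dflt ?muln0 //; apply: contra_not infA; apply: sub_finite_set.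
by move=> j [_ /= /eqP Aj]; split=> //=; apply/eqP; rewrite muln_eq0 /=.
Qed.

Lemma ideal_addn : ideal_in 0 addn [set: nat] posnats.
Proof.
by split=> //; [exists 1|move=> x y x0 _; rewrite /posnats /= addn_gt0 x0].
Qed.

Lemma ideal_muln : ideal_in 1 muln posnats posnats.
Proof.
have M x y : posnats x -> posnats y -> posnats (x * y).
  by move=> x0 y0; rewrite /posnats /= muln_gt0 x0.
by split=> //; exists 1.
Qed.

Theorem theorem3p6 (A : nat -> nat -> nat)
    (hA : monic_segmented_first_entries (fun i j => ((A i j)%:R : rat)%R))
    (r : nat) (hr : posnats r) (E : 'I_r -> set nat)
    (hE : (\bigcup_(i in [set: 'I_r]) E i)%classic = posnats) :
  exists (i : 'I_r) (x y : nat -> nat),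
    [/\ forall j, posnats (x j), forall j, posnats (y j),
        forall k, E i (omega_mulv A x k) &
        forall k, E i (omega_expv y A k)].
Proof.
pose good (B : set nat) := exists2 x : nat -> nat, forall j, posnats (x j) &
  forall k, B (omega_mulv A x k).
pose Jm := J_set muln posnats posnats.
have [q [qU qJ qq]] : exists q, [/\ UltraFilter q,
    q `<=` J_set addn [set: nat] posnats & uprod addn q q = q].
  apply: (idempotent_ultra_in addnA); first exact: (J_ultra_exists ideal_addn).
  move=> p q pU qU pJ qJ; apply: (J_ultra_uprodr ideal_addn) => //.
  exact: filterT.
have qgood : q `<=` good.
  move=> B /(msfe_image hA ideal_addn qU qq qJ)[x Px Bx].
  by exists x => // k; rewrite omega_mulvE.
have good_uprod p s : UltraFilter p -> p posnats -> s `<=` good ->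
    uprod muln p s `<=` good.
  move=> pU pP sg B /(filterI pP) /filter_ex[n [n0 /sg[x Px Bx]]].
  exists (fun j => n * x j) => [j|k].
  2: by rewrite omega_mulv_scale; exact: Bx.
  exact: ideal_mul ideal_muln _ _ n0 (Px j).
have JmP p : UltraFilter p -> p `<=` Jm -> p posnats.
  exact: J_ultra_ideal ideal_muln p.
have [p [pU pG pp]] : exists p, [/\ UltraFilter p, p `<=` good `&` Jm &
    uprod muln p p = p].
  apply: (idempotent_ultra_in mulnA).
    have [s sU sJ] := J_ultra_exists ideal_muln.
    (* The left factor [s] brings in multiplicative J-sets and the right factor [q], an additive
       idempotent, brings in images of [A]; each property survives multiplication by the other
       factor. *)
    exists (uprod muln s q); first exact: uprod_ultra.
    move=> B sqB; split.
      exact: good_uprod sU (JmP _ sU sJ) qgood _ sqB.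
    have qP := J_ultra_ideal ideal_addn qU qJ.
    exact: J_ultra_uprodl ideal_muln _ _ qU qP sJ _ sqB.
  move=> p s pU sU pG sG B psB.
  have pP : p posnats by apply: JmP => // C /pG[].
  split; first by apply: (good_uprod p s) => // C /sG[].
  by apply: (J_ultra_uprodr ideal_muln pU pP) psB => C /sG[].
have pJ : p `<=` Jm by move=> B /pG[].
(* Otherwise [p] would contain [posnats] and the complements of all finitely many colour classes. *)
have [i pEi] : exists i, p (E i).
  apply: contrapT => nE.
  have pnE : p [set x | forall i, i \in enum 'I_r -> (~` E i) x].
    apply: filter_seq => i _; apply: ultra_setC => pEi.
    by apply: nE; exists i.
  have [x [Px nEx]] := filter_ex (filterI (JmP _ pU pJ) pnE).
  by move: Px; rewrite -hE => -[i _]; apply: nEx; exact: mem_enum.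
have [[x Px Ex] _] := pG _ pEi.
have [y Py Ey] := msfe_image hA ideal_muln pU pp pJ pEi.
by exists i, x, y; split=> // k; rewrite omega_expvE.
Qed.
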